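(* Let $r\in\mathbb{N}$, $r\ge 1$. Then $$p_{r,k}=\frac{\pi}{2K(k_r)}\operatorname{sech}(\sqrt{r}\,\pi k),\qquad k\in\mathbb{Z},$$ is a probability mass function on $\mathbb{Z}$ (that is, its terms are nonnegative and sum to $1$).
   Context: $\operatorname{sech}(x)=1/\cosh(x)$. For $k\in(0,1)$, $K(k)=\int_0^{\pi/2}\frac{\mathrm{d}\vartheta}{\sqrt{1-k^2\sin^2\vartheta}}$ is the complete elliptic integral of the first kind with modulus $k$, and $K'(k)=K(\sqrt{1-k^2})$. For $r\ge 1$, $k_r=\lambda^\star(r)\in(0,1)$ denotes the (unique) modulus with $K'(k_r)/K(k_r)=\sqrt{r}$. The distribution with this probability mass function is called the discrete bilateral hyperbolic secant distribution with scaling factor $\sqrt r$. *)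

(* Defs.v *)
From Stdlib Require Import Reals ZArith ClassicalEpsilon.
From Coquelicot Require Import Coquelicot.

Local Open Scope R_scope.

Definition sech (x : R) : R := / cosh x.

(* [RInt] is total; for 0 < k < 1, the only moduli used below, the integrand
   is continuous, so this is a genuine Riemann integral. *)
Definition ellipticK (k : R) : R :=
  RInt (fun t : R => / sqrt (1 - k ^ 2 * sin t ^ 2)) 0 (PI / 2).

Definition ellipticK' (k : R) : R := ellipticK (sqrt (1 - k ^ 2)).

Definition singular_modulus (r k : R) : Prop :=
  0 < k < 1 /\ ellipticK' k / ellipticK k = sqrt r.

(* The unique singular modulus of index r, for r >= 1.  [epsilon] returns an
   unspecified real if there is none or more than one. *)
Definition lambda_star (r : R) : R :=
  epsilon (inhabits 0) (unique (singular_modulus r)).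

Definition bilateral_hyperbolic_secant (r : nat) (k : Z) : R :=
  PI / (2 * ellipticK (lambda_star (INR r))) * sech (sqrt (INR r) * PI * IZR k).

(* A bilateral series converges when its parts over k >= 0 and over k < 0
   both converge. *)
Definition is_bilateral_series (p : Z -> R) (l : R) : Prop :=
  exists a b : R,
    is_series (fun n : nat => p (Z.of_nat n)) a /\
    is_series (fun n : nat => p (- Z.of_nat (S n))%Z) b /\
    a + b = l.

Definition is_pmf_Z (p : Z -> R) : Prop :=
  (forall k : Z, 0 <= p k) /\ is_bilateral_series p 1.

(* Main.v *)
Require Import Defs.
From Stdlib Require Import Reals ZArith.
From Stdlib Require Import List FinFun Lra Lia Psatz ClassicalEpsilon.
From Coquelicot Require Import Coquelicot.
Import ListNotations.
Local Open Scope R_scope.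

(* Let A(h), B(h), C(h) be the sums over the integers n of sech(nh),
   (-1)^n sech(nh) and sech((n + 1/2)h); they are theta_3^2, theta_4^2 and
   theta_2^2 at the nome exp(-h). Splitting by the parity of n gives
   A(h) = A(2h) + C(2h) and B(h) = A(2h) - C(2h). Rearranging the double series
   of the products yields C(h)^2 = 4 A(2h) C(2h), hence A^2 = B^2 + C^2 and
   A(h) B(h) = B(2h)^2. So (A, B)(2h) is one step of the arithmetic-geometric mean
   from (A, B)(h), and (hA, hC)(h) one step from (hA, hC)(2h). By Gauss, the
   integral I(a, b) of (a^2 cos^2 + b^2 sin^2)^(-1/2) over [0, pi/2] is invariant
   under such a step. Since A, B -> 1 for h -> oo and hA, hC -> pi for h -> 0
   (compare with the integral of sech), I(A, B) = pi/2 and I(A, C) = h/2. For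
   k = C/A this reads K(k) = (pi/2) A(h) and K'(k) = (h/2) A(h); at h = pi sqrt(r)
   the modulus k is therefore k_r and A(h) = 2 K(k_r) / pi. *)

(** * Unconditional sums of nonnegative families *)

Definition sum_list {T : Type} (f : T -> R) (l : list T) : R :=
  fold_right (fun x s => f x + s) 0 l.

(** A supremum of finite partial sums, meant for nonnegative [f]. No enumeration of the index type
    is chosen, so reindexing and interchange of summation need no convergence argument. *)
Definition has_sum {T : Type} (f : T -> R) (S : R) : Prop :=
  is_lub (fun y => exists l, NoDup l /\ y = sum_list f l) S.

Lemma sum_list_app {T} (f : T -> R) l1 l2 :
  sum_list f (l1 ++ l2) = sum_list f l1 + sum_list f l2.
Proof. induction l1 as [|x l1 IH]; simpl; [lra|]. rewrite IH; lra. Qed.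

Lemma sum_list_map {T U} (f : T -> R) (g : U -> T) l :
  sum_list f (map g l) = sum_list (fun u => f (g u)) l.
Proof. induction l as [|x l IH]; simpl; [|rewrite IH]; reflexivity. Qed.

Lemma sum_list_ext {T} (f g : T -> R) l :
  (forall x, f x = g x) -> sum_list f l = sum_list g l.
Proof. intros H; induction l as [|x l IH]; simpl; [|rewrite H, IH]; reflexivity. Qed.

Lemma sum_list_le {T} (f g : T -> R) l :
  (forall x, f x <= g x) -> sum_list f l <= sum_list g l.
Proof. intros H; induction l as [|x l IH]; simpl; [lra|]. specialize (H x); lra. Qed.

Lemma sum_list_nonneg {T} (f : T -> R) l :
  (forall x, 0 <= f x) -> 0 <= sum_list f l.
Proof. intros H; induction l as [|x l IH]; simpl; [lra|]. specialize (H x); lra. Qed.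

Lemma sum_list_scal {T} (f : T -> R) (c : R) l :
  sum_list (fun x => c * f x) l = c * sum_list f l.
Proof. induction l as [|x l IH]; simpl; [|rewrite IH]; ring. Qed.

Lemma sum_list_incl {T} (f : T -> R) l l' :
  (forall x, 0 <= f x) -> NoDup l -> incl l l' -> sum_list f l <= sum_list f l'.
Proof.
  intros Hf Hl; revert l'; induction Hl as [|x l Hx Hl IH]; intros l' Hi; simpl.
  - now apply sum_list_nonneg.
  - destruct (in_split x l') as [l1 [l2 ->]]; [apply Hi; now left|].
    assert (H : incl l (l1 ++ l2)).
    { intros y Hy. assert (Hy' := Hi y (or_intror Hy)).
      apply in_app_iff in Hy'; apply in_app_iff; simpl in Hy'.
      destruct Hy' as [?|[->|?]]; tauto. }
    specialize (IH _ H). rewrite sum_list_app in *; simpl; lra.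
Qed.

Lemma sum_list_prod {T U} (f : T * U -> R) l u :
  sum_list f (list_prod l u) = sum_list (fun t => sum_list (fun v => f (t, v)) u) l.
Proof.
  induction l as [|x l IH]; simpl; [reflexivity|].
  now rewrite sum_list_app, sum_list_map, IH.
Qed.

Section HasSum.
Context {T : Type}.
Implicit Types (f g : T -> R) (S : R).

Lemma has_sum_intro f S :
  (forall l, NoDup l -> sum_list f l <= S) ->
  (forall eps, 0 < eps -> exists l, NoDup l /\ S - eps <= sum_list f l) ->
  has_sum f S.
Proof.
  intros Hu Ha; split.
  - intros y [l [Hl ->]]; auto.
  - intros b Hb. apply Rnot_lt_le; intros Hlt.
    destruct (Ha ((S - b) / 2)) as [l [Hl Hs]]; [lra|].
    assert (sum_list f l <= b) by (apply Hb; eauto). lra.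
Qed.

Lemma has_sum_ub f S l : has_sum f S -> NoDup l -> sum_list f l <= S.
Proof. intros [H _] Hl; apply H; eauto. Qed.

Lemma has_sum_approx f S eps :
  has_sum f S -> 0 < eps -> exists l, NoDup l /\ S - eps <= sum_list f l.
Proof.
  intros [_ H] He. apply NNPP; intros Hn.
  assert (S <= S - eps); [|lra].
  apply H; intros y [l [Hl ->]]. apply Rnot_lt_le; intros Hlt.
  apply Hn; exists l; split; [assumption|lra].
Qed.

Lemma has_sum_unique f S1 S2 : has_sum f S1 -> has_sum f S2 -> S1 = S2.
Proof. intros [H1 H2] [H3 H4]. apply Rle_antisym; auto. Qed.

Lemma has_sum_ext f g S : (forall x, f x = g x) -> has_sum f S -> has_sum g S.
Proof.
  intros He H; apply has_sum_intro.
  - intros l Hl. rewrite <- (sum_list_ext f g) by assumption. now apply has_sum_ub.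
  - intros eps Heps. destruct (has_sum_approx f S eps H Heps) as [l Hl].
    exists l. now rewrite <- (sum_list_ext f g).
Qed.

Lemma has_sum_bounded f b :
  (forall l, NoDup l -> sum_list f l <= b) -> exists S, has_sum f S.
Proof.
  intros H. destruct (completeness (fun y => exists l, NoDup l /\ y = sum_list f l)) as [S HS].
  - exists b; intros y [l [Hl ->]]; auto.
  - exists 0, nil; split; [constructor|reflexivity].
  - now exists S.
Qed.

Lemma has_sum_le f g S :
  (forall x, f x <= g x) -> has_sum g S -> exists S', has_sum f S'.
Proof.
  intros Hfg H; apply has_sum_bounded with S; intros l Hl.
  apply Rle_trans with (1 := sum_list_le f g l Hfg). now apply has_sum_ub.
Qed.

Lemma has_sum_scal f S c : 0 <= c -> has_sum f S -> has_sum (fun x => c * f x) (c * S).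
Proof.
  intros Hc H; apply has_sum_intro.
  - intros l Hl; rewrite sum_list_scal. apply Rmult_le_compat_l; [assumption|].
    now apply has_sum_ub.
  - intros eps He.
    (* Dividing by [c + 1] instead of [c] covers the case [c = 0]. *)
    assert (0 < eps / (c + 1)) by (apply Rdiv_lt_0_compat; lra).
    destruct (has_sum_approx f S (eps / (c + 1)) H) as [l [Hl Hs]]; [assumption|].
    exists l; split; [assumption|]. rewrite sum_list_scal.
    assert (c * (S - eps / (c + 1)) <= c * sum_list f l) by now apply Rmult_le_compat_l.
    assert (eps = c * (eps / (c + 1)) + eps / (c + 1)) by (field; lra). lra.
Qed.

End HasSum.

(** Gives a name to the sum over a subfamily, such as the even indices, before its value is
    known. *)
Lemma has_sum_comp_injective {T U} (f : T -> R) (g : U -> T) S :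
  (forall x y, g x = g y -> x = y) -> has_sum f S ->
  exists S', has_sum (fun u => f (g u)) S'.
Proof.
  intros Hg H; apply has_sum_bounded with S; intros l Hl.
  rewrite <- sum_list_map. apply has_sum_ub; [assumption|].
  now apply Injective_map_NoDup.
Qed.

Lemma has_sum_bij {T U} (f : T -> R) (g : U -> T) (g' : T -> U) S :
  (forall u, g' (g u) = u) -> (forall t, g (g' t) = t) ->
  has_sum f S -> has_sum (fun u => f (g u)) S.
Proof.
  intros H1 H2 H; apply has_sum_intro.
  - intros l Hl; rewrite <- sum_list_map. apply has_sum_ub; [assumption|].
    apply Injective_map_NoDup; [|assumption].
    intros x y E; rewrite <- (H1 x), <- (H1 y); now f_equal.
  - intros eps He. destruct (has_sum_approx f S eps H He) as [l [Hl Hs]].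
    exists (map g' l); split.
    + apply Injective_map_NoDup; [|assumption].
      intros x y E; rewrite <- (H2 x), <- (H2 y); now f_equal.
    + rewrite sum_list_map. rewrite (sum_list_ext _ f); [assumption|].
      intros x; now rewrite H2.
Qed.

(** * Double sums *)

Section Fubini.
Context {T U : Type} (f : T * U -> R) (F : T -> R).
Hypothesis f_nonneg : forall p, 0 <= f p.
Hypothesis F_sum : forall t, has_sum (fun u => f (t, u)) (F t).

(** A finite set of pairs lies in the rectangle spanned by its two projections, and each row of that
    rectangle sums to at most [F t]. *)
Lemma pairs_le_marginal p : NoDup p ->
  exists l, NoDup l /\ sum_list f p <= sum_list F l.
Proof.
  intros Hp.
  pose (decT := fun x y : T => excluded_middle_informative (x = y)).
  pose (decU := fun x y : U => excluded_middle_informative (x = y)).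
  exists (nodup decT (map fst p)); split; [apply NoDup_nodup|].
  apply Rle_trans with
    (sum_list f (list_prod (nodup decT (map fst p)) (nodup decU (map snd p)))).
  - apply sum_list_incl; [assumption|assumption|].
    intros [t u] Hin. apply in_prod; apply nodup_In, in_map_iff; exists (t, u); auto.
  - rewrite sum_list_prod. apply sum_list_le; intros t.
    apply has_sum_ub; [apply F_sum|apply NoDup_nodup].
Qed.

(** Each row over an element of [l] is approximated by a finite set, with the error [eps] shared out
    by repeated halving. *)
Lemma marginal_le_pairs l eps : NoDup l -> 0 < eps ->
  exists p, NoDup p /\ sum_list F l - eps <= sum_list f p.
Proof.
  intros Hl He.
  (* Keeping the first coordinates inside [l] makes the row added next disjoint from the rows
     already collected. *)
  enough (exists p, NoDup p /\ (forall t u, In (t, u) p -> In t l) /\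
    sum_list F l - eps <= sum_list f p) as [p Hp] by (exists p; tauto).
  revert eps He; induction Hl as [|t l Ht Hl IH]; intros eps He.
  - exists nil; simpl; split; [constructor|]. split; [tauto|lra].
  - destruct (IH (eps / 2)) as [p [Hp [Hin Hs]]]; [lra|].
    destruct (has_sum_approx _ _ (eps / 2) (F_sum t)) as [q [Hq Hqs]]; [lra|].
    exists (map (pair t) q ++ p); repeat split.
    + apply NoDup_app.
      * apply Injective_map_NoDup; [intros ? ? ?; congruence|assumption].
      * assumption.
      * intros [t' u] H1 H2. apply in_map_iff in H1 as [v [E _]].
        injection E as -> ->. apply Ht; eapply Hin; eassumption.
    + intros t' u H. apply in_app_iff in H as [H|H].
      * apply in_map_iff in H as [v [E _]]. injection E as -> ->; now left.
      * right; eapply Hin; eassumption.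
    + rewrite sum_list_app, sum_list_map; simpl; lra.
Qed.

Lemma has_sum_fubini S : has_sum f S -> has_sum F S.
Proof.
  intros H; apply has_sum_intro.
  - intros l Hl. apply Rnot_lt_le; intros Hlt.
    destruct (marginal_le_pairs l ((sum_list F l - S) / 2)) as [p [Hp Hs]]; [assumption|lra|].
    assert (Hu := has_sum_ub f S p H Hp); lra.
  - intros eps He. destruct (has_sum_approx f S eps H He) as [p [Hp Hs]].
    destruct (pairs_le_marginal p Hp) as [l [Hl Hle]].
    exists l; split; [assumption|lra].
Qed.

Lemma has_sum_tonelli S : has_sum F S -> has_sum f S.
Proof.
  intros H; apply has_sum_intro.
  - intros p Hp. destruct (pairs_le_marginal p Hp) as [l [Hl Hle]].
    assert (Hu := has_sum_ub F S l H Hl); lra.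
  - intros eps He. destruct (has_sum_approx F S (eps / 2) H) as [l [Hl Hs]]; [lra|].
    destruct (marginal_le_pairs l (eps / 2)) as [p [Hp Hps]]; [assumption|lra|].
    exists p; split; [assumption|lra].
Qed.

End Fubini.

Lemma has_sum_exchange {T U} (f : T -> U -> R) (F : T -> R) (G : U -> R) S :
  (forall t u, 0 <= f t u) ->
  (forall t, has_sum (f t) (F t)) -> (forall u, has_sum (fun t => f t u) (G u)) ->
  has_sum F S -> has_sum G S.
Proof.
  intros Hf HF HG H.
  apply (has_sum_fubini (fun p => f (snd p) (fst p))).
  - intros [u t]; apply Hf.
  - intros u; exact (HG u).
  - apply (has_sum_bij (fun p => f (fst p) (snd p)) (fun q : U * T => (snd q, fst q))
      (fun q => (snd q, fst q))); [now intros []|now intros []|].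
    apply has_sum_tonelli with F; [intros []; apply Hf|exact HF|assumption].
Qed.

Lemma has_sum_bool (f : bool -> R) :
  (forall b, 0 <= f b) -> has_sum f (f true + f false).
Proof.
  intros Hf; apply has_sum_intro.
  - intros l Hl. replace (f true + f false) with (sum_list f [true; false]) by (simpl; ring).
    apply sum_list_incl; [assumption|assumption|]. intros [] _; simpl; tauto.
  - intros eps He. exists [true; false]; split; [|simpl; lra].
    repeat constructor; simpl; intuition discriminate.
Qed.

(** Adding two families is interchanging the order of summation in a double series indexed by [bool]
    and [T]. *)
Lemma has_sum_plus {T} (f g : T -> R) a b :
  (forall x, 0 <= f x) -> (forall x, 0 <= g x) ->
  has_sum f a -> has_sum g b -> has_sum (fun x => f x + g x) (a + b).
Proof.
  intros Hf Hg Ha Hb.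
  apply (has_sum_exchange (fun (i : bool) x => if i then f x else g x)
    (fun i => if i then a else b)).
  - intros [] x; auto.
  - intros []; assumption.
  - intros x. apply (has_sum_bool (fun i => if i then f x else g x)). intros []; auto.
  - apply (has_sum_bool (fun i => if i then a else b)).
    intros []; [apply (has_sum_ub f a [] Ha)|apply (has_sum_ub g b [] Hb)]; constructor.
Qed.

Lemma has_sum_split {T U} (f : T -> R) (g : bool * U -> T) (g' : T -> bool * U) a b :
  (forall x, 0 <= f x) -> (forall u, g' (g u) = u) -> (forall t, g (g' t) = t) ->
  has_sum (fun u => f (g (true, u))) a -> has_sum (fun u => f (g (false, u))) b ->
  has_sum f (a + b).
Proof.
  intros Hf H1 H2 Ha Hb.
  apply has_sum_ext with (fun t => f (g (g' t))); [intros x; now rewrite H2|].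
  apply (has_sum_bij (fun u => f (g u)) g' g); [assumption|assumption|].
  apply has_sum_tonelli with (fun i : bool => if i then a else b).
  - intros p; apply Hf.
  - intros []; assumption.
  - apply (has_sum_bool (fun i => if i then a else b)).
    intros []; [apply (has_sum_ub _ a [] Ha)|apply (has_sum_ub _ b [] Hb)]; constructor.
Qed.

(** * Series over the naturals and the integers *)

Lemma sum_list_seq (f : nat -> R) n : sum_list f (seq 0 (S n)) = sum_n f n.
Proof.
  induction n as [|n IH].
  - simpl; rewrite sum_O; ring.
  - rewrite seq_S, sum_list_app, IH, sum_Sn; simpl. unfold plus; simpl; ring.
Qed.

(** Every finite set of naturals lies in an initial segment, so for nonnegative terms the supremum
    over finite sets is the limit of the partial sums. *)
Lemma has_sum_nat (f : nat -> R) S :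
  (forall n, 0 <= f n) -> has_sum f S <-> is_series f S.
Proof.
  intros Hf.
  assert (Hle : forall n m, (n <= m)%nat -> sum_n f n <= sum_n f m).
  { intros n m Hnm. rewrite <- !sum_list_seq. apply sum_list_incl; [assumption|apply seq_NoDup|].
    intros x Hx; apply in_seq in Hx; apply in_seq; lia. }
  split; intros H.
  - enough (Hlim : is_lim_seq (sum_n f) S) by exact Hlim.
    apply is_lim_seq_spec. intros eps.
    destruct (has_sum_approx f S (eps / 2) H) as [l [Hl Hs]];
      [destruct eps; simpl; lra|].
    exists (list_max l); intros n Hn.
    assert (H1 : sum_list f l <= sum_n f n).
    { rewrite <- sum_list_seq. apply sum_list_incl; [assumption|assumption|].
      intros x Hx. assert (Hm := list_max_le l n). apply proj1 in Hm. specialize (Hm Hn).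
      rewrite Forall_forall in Hm. specialize (Hm x Hx). apply in_seq; lia. }
    assert (H2 : sum_n f n <= S).
    { rewrite <- sum_list_seq. apply has_sum_ub; [assumption|apply seq_NoDup]. }
    destruct eps as [e He]; simpl in *. apply Rabs_lt_between'; lra.
  - assert (Hlim : is_lim_seq (sum_n f) S) by exact H.
    apply has_sum_intro.
    + intros l Hl.
      apply Rle_trans with (sum_n f (list_max l)).
      * rewrite <- sum_list_seq. apply sum_list_incl; [assumption|assumption|].
        intros x Hx. assert (Hm := list_max_le l (list_max l)). apply proj1 in Hm.
        specialize (Hm (le_n _)).
        rewrite Forall_forall in Hm. specialize (Hm x Hx). apply in_seq; lia.
      * apply (is_lim_seq_incr_compare (sum_n f)); [assumption|]. intros n; apply Hle; lia.
    + intros eps He. apply is_lim_seq_spec in Hlim.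
      destruct (Hlim (mkposreal eps He)) as [N HN]. simpl in HN.
      specialize (HN N (le_n _)). apply Rabs_lt_between' in HN.
      exists (seq 0 (Datatypes.S N)); split; [apply seq_NoDup|]. rewrite sum_list_seq; lra.
Qed.

Lemma has_sum_Z (f : Z -> R) a b :
  (forall n, 0 <= f n) ->
  is_series (fun n => f (Z.of_nat n)) a ->
  is_series (fun n => f (- Z.of_nat (S n))%Z) b ->
  has_sum f (a + b).
Proof.
  intros Hf Ha Hb.
  apply (has_sum_split f
    (fun p : bool * nat => if fst p then Z.of_nat (snd p) else (- Z.of_nat (S (snd p)))%Z)
    (fun z => if Z_le_gt_dec 0 z then (true, Z.to_nat z) else (false, Z.to_nat (- z - 1)))).
  - assumption.
  - intros [[] n]; cbn [fst snd].
    + destruct (Z_le_gt_dec 0 (Z.of_nat n)); [|lia]. now rewrite Nat2Z.id.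
    + destruct (Z_le_gt_dec 0 (- Z.of_nat (S n))); [lia|]. f_equal; lia.
  - intros z. destruct (Z_le_gt_dec 0 z); cbn [fst snd]; lia.
  - apply has_sum_nat; [intros; apply Hf|assumption].
  - apply has_sum_nat; [intros; apply Hf|assumption].
Qed.

Lemma has_sum_even_odd (f : Z -> R) a b :
  (forall n, 0 <= f n) ->
  has_sum (fun n => f (2 * n)%Z) a -> has_sum (fun n => f (2 * n + 1)%Z) b ->
  has_sum f (a + b).
Proof.
  intros Hf Ha Hb.
  apply (has_sum_split f
    (fun p : bool * Z => if fst p then (2 * snd p)%Z else (2 * snd p + 1)%Z)
    (fun z => (Z.even z, (z / 2)%Z))); cbn [fst snd]; try assumption.
  - intros [[] n]; cbn [fst snd]; f_equal.
    + now rewrite Z.even_mul.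
    + rewrite Z.mul_comm; now apply Z.div_mul.
    + now rewrite Z.even_add, Z.even_mul.
    + rewrite Z.mul_comm, Z.div_add_l by lia. now rewrite Z.add_0_r.
  - intros z. assert (H := Z.div_mod z 2 ltac:(lia)). rewrite Zmod_even in H.
    destruct (Z.even z); lia.
Qed.

Lemma has_sum_shift (f : Z -> R) (s : Z) S :
  has_sum f S -> has_sum (fun n => f (n + s)%Z) S.
Proof.
  apply (has_sum_bij f (fun n => (n + s)%Z) (fun n => (n - s)%Z)); intros; lia.
Qed.

Lemma has_sum_reflect (f : Z -> R) (s : Z) S :
  has_sum f S -> has_sum (fun n => f (s - n)%Z) S.
Proof.
  apply (has_sum_bij f (fun n => (s - n)%Z) (fun n => (s - n)%Z)); intros; lia.
Qed.

(** For [s = 1] the two halves of the integers telescope separately, meeting at [g 0]. A difference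
    over [s] steps is a sum of [s] shifted unit differences. Monotonicity of [g] keeps all terms
    nonnegative. *)
Lemma has_sum_telescope (g : Z -> R) (l m : R) (s : nat) :
  (forall n, g n <= g (n + 1)%Z) ->
  is_lim_seq (fun n => g (Z.of_nat n)) l ->
  is_lim_seq (fun n => g (- Z.of_nat n)%Z) m ->
  has_sum (fun n => g (n + Z.of_nat s)%Z - g n) (INR s * (l - m)).
Proof.
  intros Hg Hl Hm.
  assert (H1 : has_sum (fun n => g (n + 1)%Z - g n) (l - m)).
  { replace (l - m) with ((l - g 0%Z) + (g 0%Z - m)) by ring.
    apply has_sum_Z.
    - intros n; specialize (Hg n); lra.
    - change (is_lim_seq (sum_n (fun n => g (Z.of_nat n + 1)%Z - g (Z.of_nat n))) (l - g 0%Z)).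
      apply is_lim_seq_ext with (fun n => g (Z.of_nat (S n)) - g 0%Z).
      + intros n; induction n as [|n IH].
        * now rewrite sum_O.
        * rewrite sum_Sn, <- IH. replace (Z.of_nat (S n) + 1)%Z with (Z.of_nat (S (S n))) by lia.
          cbv [plus AbelianMonoid.plus]; simpl. lra.
      + apply is_lim_seq_minus'; [|apply is_lim_seq_const].
        now apply (is_lim_seq_incr_1 (fun n => g (Z.of_nat n))).
    - change (is_lim_seq (sum_n (fun n => g (- Z.of_nat (S n) + 1)%Z - g (- Z.of_nat (S n))%Z))
        (g 0%Z - m)).
      apply is_lim_seq_ext with (fun n => g 0%Z - g (- Z.of_nat (S n))%Z).
      + intros n; induction n as [|n IH].
        * now rewrite sum_O.
        * rewrite sum_Sn, <- IH.
          replace (- Z.of_nat (S (S n)) + 1)%Z with (- Z.of_nat (S n))%Z by lia.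
          unfold plus; simpl. lra.
      + apply is_lim_seq_minus'; [apply is_lim_seq_const|].
        now apply (is_lim_seq_incr_1 (fun n => g (- Z.of_nat n)%Z)). }
  assert (Hmono : forall n (k : nat), g n <= g (n + Z.of_nat k)%Z).
  { intros n k; induction k as [|k IH].
    - rewrite Z.add_0_r; lra.
    - apply Rle_trans with (1 := IH).
      replace (n + Z.of_nat (S k))%Z with (n + Z.of_nat k + 1)%Z by lia. apply Hg. }
  induction s as [|s IH].
  - apply has_sum_ext with (fun _ => 0 * 0).
    + intros n; rewrite Z.add_0_r; ring.
    + replace (INR 0 * (l - m)) with (0 * (l - m)) by reflexivity.
      (* The zero family is 0 times the unit differences, hence has sum 0. *)
      apply has_sum_ext with (fun n => 0 * (g (n + 1)%Z - g n)); [intros; ring|].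
      apply has_sum_scal; [lra|assumption].
  - rewrite S_INR.
    replace ((INR s + 1) * (l - m)) with (INR s * (l - m) + (l - m)) by ring.
    apply has_sum_ext with
      (fun n => (g (n + Z.of_nat s)%Z - g n)
                + (g (n + Z.of_nat s + 1)%Z - g (n + Z.of_nat s)%Z)).
    + intros n. replace (n + Z.of_nat (S s))%Z with (n + Z.of_nat s + 1)%Z by lia. ring.
    + apply has_sum_plus.
      * intros n; specialize (Hmono n s); lra.
      * intros n; specialize (Hg (n + Z.of_nat s)%Z); lra.
      * assumption.
      * apply (has_sum_shift (fun n => g (n + 1)%Z - g n)); assumption.
Qed.

(** * Bilateral series of the hyperbolic secant *)

Lemma cosh_pos x : 0 < cosh x.
Proof. unfold cosh. assert (H1 := exp_pos x). assert (H2 := exp_pos (- x)). lra. Qed.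

Lemma sech_pos x : 0 < sech x.
Proof. apply Rinv_0_lt_compat, cosh_pos. Qed.

Lemma sech_opp x : sech (- x) = sech x.
Proof. unfold sech, cosh. now rewrite Ropp_involutive, (Rplus_comm (exp (- x))). Qed.

Lemma sech_0 : sech 0 = 1.
Proof. unfold sech; rewrite cosh_0; apply Rinv_1. Qed.

Lemma cosh_sqr x : cosh x ^ 2 = 1 + sinh x ^ 2.
Proof.
  unfold cosh, sinh. assert (H : exp x * exp (- x) = 1)
    by (rewrite <- exp_plus, Rplus_opp_r; apply exp_0).
  transitivity (exp x * exp (- x) + ((exp x - exp (- x)) / 2) ^ 2); [field|lra].
Qed.

(** By [cosh_sqr] this reduces to the monotonicity of [sinh]. *)
Lemma sech_decreasing x y : 0 <= x <= y -> sech y <= sech x.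
Proof.
  intros H. apply Rinv_le_contravar; [apply cosh_pos|].
  apply Rsqr_incr_0_var; [|apply Rlt_le, cosh_pos].
  rewrite !Rsqr_pow2, !cosh_sqr.
  assert (sinh 0 <= sinh x <= sinh y).
  { split; [destruct (Req_dec x 0) as [->|]; [lra|]|destruct (Req_dec x y) as [->|]; [lra|]];
    apply Rlt_le, sinh_lt; lra. }
  rewrite sinh_0 in *. nra.
Qed.

(* The integral of sech over [x, y] is atan (sinh y) - atan (sinh x). *)
Lemma gudermannian_step x y : 0 <= x <= y ->
  (y - x) * sech y <= atan (sinh y) - atan (sinh x) <= (y - x) * sech x.
Proof.
  intros Hxy.
  destruct (MVT_gen (fun t => atan (sinh t)) x y sech) as [c [Hc E]].
  - intros t _. assert (Hd : is_derive sinh t (cosh t))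
      by (apply is_derive_Reals, derivable_pt_lim_sinh).
    replace (sech t) with (scal (cosh t) (/ (1 + Rsqr (sinh t)))).
    + apply (is_derive_comp atan sinh); [apply is_derive_atan|assumption].
    + unfold scal; simpl; unfold mult; simpl. rewrite Rsqr_pow2, <- cosh_sqr.
      unfold sech. assert (H := cosh_pos t). field; lra.
  - intros t _. apply continuity_pt_comp with (f1 := sinh).
    + apply derivable_continuous_pt, derivable_pt_sinh.
    + apply derivable_continuous_pt, derivable_pt_atan.
  - rewrite Rmin_left, Rmax_right in Hc by lra. rewrite E.
    assert (sech y <= sech c) by (apply sech_decreasing; lra).
    assert (sech c <= sech x) by (apply sech_decreasing; lra). nra.
Qed.

Lemma is_lim_seq_exp_linear v h : 0 < h -> is_lim_seq (fun n => exp (- (v + INR n * h))) 0.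
Proof.
  intros Hh. apply is_lim_seq_ext with (fun n => exp (- v) * exp (- h) ^ n).
  - intros n; induction n as [|n IH].
    + simpl; rewrite Rmult_1_r; f_equal; ring.
    + rewrite S_INR. simpl pow.
      transitivity (exp (- h) * (exp (- v) * exp (- h) ^ n)); [ring|].
      rewrite IH, <- exp_plus. f_equal; ring.
  - replace (Finite 0) with (Rbar_mult (exp (- v)) 0) by (simpl; f_equal; ring).
    apply is_lim_seq_scal_l. apply is_lim_seq_geom.
    rewrite Rabs_pos_eq by apply Rlt_le, exp_pos.
    rewrite <- exp_0. apply exp_increasing; lra.
Qed.

(** With [u = exp (- y)], [1 / sinh y = 2 u / (1 - u^2)], and [atan (sinh y)] is [PI / 2] minus the
    arctangent of this. The limit at infinity becomes continuity at [u = 0]. *)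
Lemma is_lim_seq_atan_sinh h : 0 < h ->
  is_lim_seq (fun n => atan (sinh (INR n * h))) (PI / 2).
Proof.
  intros Hh.
  (* The term at index 0 is dropped because [1 / sinh y] requires [y > 0]. *)
  apply is_lim_seq_incr_1.
  assert (E : forall y, 0 < y ->
    atan (sinh y) = PI / 2 - atan (2 * exp (- y) / (1 - exp (- y) ^ 2))).
  { intros y Hy.
    assert (Hs : 0 < sinh y) by (rewrite <- sinh_0; now apply sinh_lt).
    rewrite <- (Rinv_inv (sinh y)), atan_inv by now apply Rinv_0_lt_compat.
    do 2 f_equal. unfold sinh in *. rewrite exp_Ropp in *. assert (H := exp_pos y).
    field. assert (exp y > 1) by (rewrite <- exp_0; now apply exp_increasing).
    repeat split; nra. }
  apply is_lim_seq_ext with (fun n =>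
    PI / 2 - atan (2 * exp (- (h + INR n * h)) / (1 - exp (- (h + INR n * h)) ^ 2))).
  { intros n. rewrite <- E.
    - rewrite S_INR; do 2 f_equal; ring.
    - assert (Hn := pos_INR n). nra. }
  set (f := fun u => PI / 2 - atan (2 * u / (1 - u ^ 2))).
  assert (E0 : f 0 = PI / 2).
  { unfold f. replace (2 * 0 / (1 - 0 ^ 2)) with 0 by field. rewrite atan_0; ring. }
  assert (L : is_lim_seq (fun n => f (exp (- (h + INR n * h)))) (f 0));
    [|now rewrite E0 in L].
  apply (is_lim_seq_continuous f).
  - apply continuity_pt_filterlim, (ex_derive_continuous (V := R_NormedModule)).
    unfold f; auto_derive. lra.
  - now apply is_lim_seq_exp_linear.
Qed.

(** Again [u = exp (- y)] turns the limit into continuity at 0, now of [(1 - u^2) / (1 + u^2)]. *)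
Lemma is_lim_seq_tanh v h : 0 < h ->
  is_lim_seq (fun n => tanh (v + INR n * h)) 1.
Proof.
  intros Hh.
  assert (E : forall y, tanh y = (1 - exp (- y) ^ 2) / (1 + exp (- y) ^ 2)).
  { intros y. unfold tanh, sinh, cosh. rewrite exp_Ropp. assert (H := exp_pos y).
    field. split; nra. }
  apply is_lim_seq_ext with
    (fun n => (1 - exp (- (v + INR n * h)) ^ 2) / (1 + exp (- (v + INR n * h)) ^ 2)).
  { intros n; now rewrite E. }
  set (f := fun u => (1 - u ^ 2) / (1 + u ^ 2)).
  assert (E0 : f 0 = 1) by (unfold f; field).
  assert (L : is_lim_seq (fun n => f (exp (- (v + INR n * h)))) (f 0));
    [|now rewrite E0 in L].
  apply (is_lim_seq_continuous f).
  - apply continuity_pt_filterlim, (ex_derive_continuous (V := R_NormedModule)).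
    unfold f; auto_derive. lra.
  - now apply is_lim_seq_exp_linear.
Qed.

Lemma tanh_sub x y : tanh y - tanh x = sinh (y - x) * (sech x * sech y).
Proof.
  unfold tanh, sech. assert (Hx := cosh_pos x). assert (Hy := cosh_pos y).
  replace (sinh (y - x)) with (sinh y * cosh x - cosh y * sinh x); [field; lra|].
  unfold sinh, cosh. replace (- (y - x)) with (x + - y) by ring.
  unfold Rminus. rewrite !exp_plus. field.
Qed.

Lemma tanh_opp x : tanh (- x) = - tanh x.
Proof.
  unfold tanh, sinh, cosh. rewrite Ropp_involutive.
  assert (H1 := exp_pos x). assert (H2 := exp_pos (- x)). field. lra.
Qed.

Lemma sinh_opp x : sinh (- x) = - sinh x.
Proof. unfold sinh. rewrite Ropp_involutive. field. Qed.

Lemma sinh_pos x : 0 < x -> 0 < sinh x.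
Proof. intros Hx; rewrite <- sinh_0; now apply sinh_lt. Qed.

(* sech x sech y is a difference of hyperbolic tangents, so the sum telescopes. *)
Lemma has_sum_sech_pair_nat v h (s : nat) : 0 < h -> (0 < s)%nat ->
  has_sum (fun n => sech (v + IZR n * h) * sech (v + IZR (n + Z.of_nat s) * h))
    (2 * INR s / sinh (INR s * h)).
Proof.
  intros Hh Hs. apply lt_0_INR in Hs.
  assert (Hsinh : 0 < sinh (INR s * h)) by (apply sinh_pos; nra).
  (* The factor 2 is [1 - -1], the difference of the limits of [tanh] at the two ends. *)
  replace (2 * INR s / sinh (INR s * h))
    with (/ sinh (INR s * h) * (INR s * (1 - -1))) by (field; lra).
  apply has_sum_ext with (fun n => / sinh (INR s * h)
    * (tanh (v + IZR (n + Z.of_nat s) * h) - tanh (v + IZR n * h))).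
  { intros n. rewrite tanh_sub.
    replace (v + IZR (n + Z.of_nat s) * h - (v + IZR n * h)) with (INR s * h)
      by (rewrite plus_IZR, <- INR_IZR_INZ; ring).
    field; lra. }
  apply has_sum_scal; [apply Rlt_le, Rinv_0_lt_compat; assumption|].
  apply (has_sum_telescope (fun n => tanh (v + IZR n * h))).
  - intros n. apply Rminus_le_0. rewrite tanh_sub, plus_IZR.
    replace (v + (IZR n + 1) * h - (v + IZR n * h)) with h by ring.
    assert (H1 := sinh_pos h Hh).
    assert (H2 := sech_pos (v + IZR n * h)).
    assert (H3 := sech_pos (v + (IZR n + 1) * h)).
    apply Rlt_le, Rmult_lt_0_compat; [assumption|]. now apply Rmult_lt_0_compat.
  - apply is_lim_seq_ext with (fun n => tanh (v + INR n * h)).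
    + intros n; now rewrite INR_IZR_INZ.
    + now apply is_lim_seq_tanh.
  - apply is_lim_seq_ext with (fun n => - tanh (- v + INR n * h)).
    + intros n. rewrite opp_IZR, <- INR_IZR_INZ, <- tanh_opp. f_equal; ring.
    + change (Finite (-1)) with (Rbar_opp 1). apply -> is_lim_seq_opp.
      now apply is_lim_seq_tanh.
Qed.

(** Both sides are even in [s], which reduces negative gaps to positive ones. The gap 0 has to be
    excluded, since the formula divides by [sinh (IZR s * h)]. *)
Lemma has_sum_sech_pair v h (s : Z) : 0 < h -> s <> 0%Z ->
  has_sum (fun n => sech (v + IZR n * h) * sech (v + IZR (n + s) * h))
    (2 * IZR s / sinh (IZR s * h)).
Proof.
  intros Hh Hs. destruct (Z_lt_le_dec s 0) as [Hneg|Hpos].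
  - assert (H := has_sum_sech_pair_nat v h (Z.to_nat (- s)) Hh ltac:(lia)).
    rewrite INR_IZR_INZ, Z2Nat.id, opp_IZR in H by lia.
    replace (- IZR s * h) with (- (IZR s * h)) in H by ring. rewrite sinh_opp in H.
    assert (Hsinh : sinh (IZR s * h) < 0).
    { apply IZR_lt in Hneg. rewrite <- sinh_0. apply sinh_lt; nra. }
    replace (2 * IZR s / sinh (IZR s * h))
      with (2 * - IZR s / - sinh (IZR s * h)) by (field; lra).
    (* Shifting the index by [s] swaps the two factors of each term. *)
    apply (has_sum_shift _ s) in H. revert H; apply has_sum_ext; intros n.
    rewrite Rmult_comm. do 4 f_equal. f_equal. lia.
  - assert (H := has_sum_sech_pair_nat v h (Z.to_nat s) Hh ltac:(lia)).
    now rewrite INR_IZR_INZ, Z2Nat.id in H by lia.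
Qed.

(** * The sums A(h) and C(h) *)

(** This is [A(h)], folded by the evenness of [sech]: the term at 0 is 1 and the others occur in
    equal pairs. *)
Definition sech_sum (h : R) : R := 1 + 2 * Series (fun n => sech (INR (S n) * h)).

Section SechSum.
Variable h : R.
Hypothesis h_pos : 0 < h.
Let Q := Series (fun n => sech (INR (S n) * h)).

(** Right and left Riemann sums of the decreasing function [sech] enclose its integral over
    [[0, (n + 1) h]]. *)
Lemma sech_partial_sum_bounds n :
  h * sum_n (fun k => sech (INR (S k) * h)) n <= atan (sinh (INR (S n) * h))
  <= h * (1 + sum_n (fun k => sech (INR (S k) * h)) n).
Proof.
  assert (Hstep : forall k, h * sech (INR (S k) * h)
    <= atan (sinh (INR (S k) * h)) - atan (sinh (INR k * h)) <= h * sech (INR k * h)).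
  { intros k. assert (Hk := pos_INR k).
    destruct (gudermannian_step (INR k * h) (INR (S k) * h)) as [H1 H2];
      [rewrite S_INR; nra|].
    replace (INR (S k) * h - INR k * h) with h in * by (rewrite S_INR; ring). lra. }
  (* The induction carries the exact left Riemann sum, whose nodes run from 0 to [n h]; the last
     term of [sum_n], at [(n + 1) h], is therefore subtracted. *)
  enough (h * sum_n (fun k => sech (INR (S k) * h)) n <= atan (sinh (INR (S n) * h))
    <= h * (1 + sum_n (fun k => sech (INR (S k) * h)) n - sech (INR (S n) * h))) as H.
  { assert (Hs := sech_pos (INR (S n) * h)). nra. }
  induction n as [|n IH].
  - rewrite sum_O. specialize (Hstep 0%nat). simpl INR in *.
    rewrite Rmult_0_l, sinh_0, sech_0, atan_0 in Hstep. lra.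
  - rewrite sum_Sn. specialize (Hstep (S n)).
    cbv [plus AbelianMonoid.plus]; simpl in IH |- *; simpl in Hstep. lra.
Qed.

Lemma is_series_sech : is_series (fun n => sech (INR (S n) * h)) Q.
Proof.
  apply Series_correct.
  destruct (ex_finite_lim_seq_incr (sum_n (fun n => sech (INR (S n) * h))) (PI / 2 / h))
    as [l Hl].
  - intros n. rewrite sum_Sn. assert (H := sech_pos (INR (S (S n)) * h)).
    cbv [plus AbelianMonoid.plus]; simpl in *. lra.
  - intros n. apply Rmult_le_reg_l with h; [assumption|].
    replace (h * (PI / 2 / h)) with (PI / 2) by (field; lra).
    assert (H := sech_partial_sum_bounds n).
    assert (H' := atan_bound (sinh (INR (S n) * h))). lra.
  - exists l. exact Hl.
Qed.

Lemma half_sech_sum_bounds : 0 <= Q /\ h * Q <= PI / 2 <= h * (1 + Q).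
Proof.
  assert (Hl : is_lim_seq (sum_n (fun n => sech (INR (S n) * h))) Q) by exact is_series_sech.
  assert (Hhl := is_lim_seq_scal_l _ h _ Hl).
  repeat split.
  - apply (is_lim_seq_le (fun _ => 0) (sum_n (fun n => sech (INR (S n) * h))) 0 Q);
      [|apply is_lim_seq_const|assumption].
    intros n. rewrite <- sum_list_seq. apply sum_list_nonneg; intros; apply Rlt_le, sech_pos.
  - apply (is_lim_seq_le _ (fun _ => PI / 2) (h * Q) (PI / 2)) with (2 := Hhl);
      [|apply is_lim_seq_const].
    intros n. assert (H := sech_partial_sum_bounds n).
    assert (H' := atan_bound (sinh (INR (S n) * h))). lra.
  - apply (is_lim_seq_le (fun n => atan (sinh (INR (S n) * h)))
      (fun n => h * (1 + sum_n (fun n => sech (INR (S n) * h)) n)) (PI / 2) (h * (1 + Q))).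
    + intros n; apply sech_partial_sum_bounds.
    + apply (is_lim_seq_incr_1 (fun n => atan (sinh (INR n * h)))).
      now apply is_lim_seq_atan_sinh.
    + change (Finite (h * (1 + Q))) with (Rbar_mult h (1 + Q)).
      apply is_lim_seq_scal_l. apply is_lim_seq_plus'; [apply is_lim_seq_const|assumption].
Qed.

Lemma is_series_sech_nonneg : is_series (fun n => sech (IZR (Z.of_nat n) * h)) (1 + Q).
Proof.
  apply is_series_decr_1; cbv beta.
  change (is_series (fun n => sech (IZR (Z.of_nat (S n)) * h))
    (1 + Q + - sech (IZR (Z.of_nat 0) * h))).
  replace (1 + Q + - sech (IZR (Z.of_nat 0) * h)) with Q
    by (simpl Z.of_nat; rewrite Rmult_0_l, sech_0; ring).
  apply is_series_ext with (2 := is_series_sech).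
  intros n; now rewrite INR_IZR_INZ.
Qed.

Lemma is_series_sech_neg : is_series (fun n => sech (IZR (- Z.of_nat (S n)) * h)) Q.
Proof.
  apply is_series_ext with (2 := is_series_sech).
  intros n. rewrite opp_IZR, INR_IZR_INZ, <- sech_opp. f_equal; ring.
Qed.

Lemma has_sum_sech : has_sum (fun n : Z => sech (IZR n * h)) (sech_sum h).
Proof.
  unfold sech_sum; fold Q. replace (1 + 2 * Q) with ((1 + Q) + Q) by ring.
  apply has_sum_Z; [|exact is_series_sech_nonneg|exact is_series_sech_neg].
  intros n; apply Rlt_le, sech_pos.
Qed.

(** The first pair of bounds gives [A(h) -> 1] as [h] grows, the second [h A(h) -> PI] as
    [h -> 0]. *)
Lemma sech_sum_bounds : 1 <= sech_sum h <= 1 + PI / h /\ PI - h <= h * sech_sum h <= PI + h.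
Proof.
  destruct half_sech_sum_bounds as [H1 [H2 H3]]. unfold sech_sum; fold Q.
  repeat split; try lra. apply Rmult_le_reg_l with h; [assumption|].
  replace (h * (1 + PI / h)) with (h + PI) by (field; lra). lra.
Qed.

End SechSum.

(** This is [C(h)]: among the terms [sech (n h / 2)] of [A(h / 2)], those with [n] even make up
    [A(h)] and those with [n] odd make up [C(h)]. *)
Definition sech_half_sum (h : R) : R := sech_sum (h / 2) - sech_sum h.

Lemma has_sum_sech_half h : 0 < h ->
  has_sum (fun n : Z => sech ((IZR n + / 2) * h)) (sech_half_sum h).
Proof.
  intros Hh.
  assert (H := has_sum_sech (h / 2) ltac:(lra)).
  destruct (has_sum_comp_injective _ (fun n => 2 * n + 1)%Z _ ltac:(cbv beta; intros; lia) H)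
    as [C HC].
  assert (HE : has_sum (fun n => sech (IZR (2 * n) * (h / 2))) (sech_sum h)).
  { apply has_sum_ext with (2 := has_sum_sech h Hh).
    intros n; rewrite mult_IZR. f_equal; field. }
  assert (E := has_sum_unique _ _ _ H (has_sum_even_odd (fun n => sech (IZR n * (h / 2))) _ _
    (fun n => Rlt_le _ _ (sech_pos _)) HE HC)).
  unfold sech_half_sum. replace (sech_sum (h / 2) - sech_sum h) with C by lra.
  revert HC; apply has_sum_ext; intros n. rewrite plus_IZR, mult_IZR. f_equal; field.
Qed.

Lemma sech_sum_split h : sech_sum h = sech_sum (2 * h) + sech_half_sum (2 * h).
Proof. unfold sech_half_sum. replace (2 * h / 2) with h by field. ring. Qed.

Lemma sech_half_sum_pos h : 0 < h -> 0 < sech_half_sum h.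
Proof.
  intros Hh. apply Rlt_le_trans with (sech ((IZR 0 + / 2) * h)); [apply sech_pos|].
  assert (H := has_sum_ub _ _ (0%Z :: nil) (has_sum_sech_half h Hh)).
  unfold sum_list in H; cbn [fold_right] in H. rewrite Rplus_0_r in H. apply H.
  repeat constructor; simpl; tauto.
Qed.

(** * Products of bilateral series *)

(** The product of the sums is a double series over pairs of indices, here summed along the
    diagonals of constant difference [j]. *)
Lemma has_sum_shear (a b : Z -> R) (A B : R) (G : Z -> R) :
  (forall n, 0 <= a n) -> (forall n, 0 <= b n) -> has_sum a A -> has_sum b B ->
  (forall j, has_sum (fun m => a m * b (m + j)%Z) (G j)) -> has_sum G (A * B).
Proof.
  intros Ha Hb HA HB HG.
  apply (has_sum_exchange (fun m j => a m * b (m + j)%Z) (fun m => B * a m)).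
  - intros m j; now apply Rmult_le_pos.
  - intros m. rewrite Rmult_comm. apply has_sum_scal; [apply Ha|].
    apply has_sum_ext with (fun j => b (j + m)%Z).
    + intros j; now rewrite Z.add_comm.
    + now apply has_sum_shift.
  - exact HG.
  - rewrite Rmult_comm. apply has_sum_scal; [|assumption].
    apply (has_sum_ub b B [] HB). constructor.
Qed.

(** In units of [h], [A(2h)] runs over the even nodes and [C(2h)] over the odd ones, so the [j]-th
    diagonal pairs [2m] with [2m + 2j + 1]. It is the even half of a telescoping sum of gap
    [2j + 1]. *)
Lemma has_sum_even_odd_product h : 0 < h ->
  has_sum (fun j => IZR (2 * j + 1) / sinh (IZR (2 * j + 1) * h))
    (sech_sum (2 * h) * sech_half_sum (2 * h)).
Proof.
  intros Hh.
  apply (has_sum_shear (fun m => sech (IZR m * (2 * h)))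
    (fun n => sech ((IZR n + / 2) * (2 * h)))).
  1, 2: intros; apply Rlt_le, sech_pos.
  - apply has_sum_sech; lra.
  - apply has_sum_sech_half; lra.
  - intros j.
    set (c := fun n => sech (0 + IZR n * h) * sech (0 + IZR (n + (2 * j + 1)) * h)).
    assert (Hc : has_sum c (2 * IZR (2 * j + 1) / sinh (IZR (2 * j + 1) * h)))
      by (apply has_sum_sech_pair; [assumption|lia]).
    destruct (has_sum_comp_injective _ (fun n => 2 * n)%Z _ ltac:(cbv beta; intros; lia) Hc)
      as [W HW].
    (* The reflection sending [N] to [- N - (2j + 1)] preserves [c] and exchanges even and odd [N].
       The two halves are thus equal, and each is half of the total. *)
    assert (HW' : has_sum (fun n => c (2 * n + 1)%Z) W).
    { apply (has_sum_reflect _ (- j - 1)) in HW. revert HW; apply has_sum_ext.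
      intros n; unfold c. rewrite Rmult_comm.
      f_equal; rewrite <- sech_opp; f_equal;
        rewrite !Rplus_0_l, Ropp_mult_distr_l, <- opp_IZR; do 2 f_equal; lia. }
    assert (Hcn : forall n, 0 <= c n).
    { intros n; unfold c. apply Rlt_le, Rmult_lt_0_compat; apply sech_pos. }
    assert (E := has_sum_unique _ _ _ Hc (has_sum_even_odd c W W Hcn HW HW')).
    replace (IZR (2 * j + 1) / sinh (IZR (2 * j + 1) * h)) with W.
    2:{ unfold Rdiv in E |- *. lra. }
    revert HW; apply has_sum_ext; intros m; unfold c.
    rewrite !plus_IZR, !mult_IZR. f_equal; f_equal; field.
Qed.

(* Write C^2 as a sum over (m, m + j). The terms with j odd give 2 A(2h) C(2h);
   for j = 2i, the product of the terms at m - i and m + i is symmetric in i and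
   m + 1/2, which reduces this case to the previous one. *)
Theorem sech_half_sum_sqr h : 0 < h ->
  sech_half_sum h ^ 2 = 4 * (sech_sum (2 * h) * sech_half_sum (2 * h)).
Proof.
  intros Hh. set (P := sech_sum (2 * h) * sech_half_sum (2 * h)).
  set (d := fun n => sech ((IZR n + / 2) * h)).
  assert (Hd := has_sum_sech_half h Hh). change (has_sum d (sech_half_sum h)) in Hd.
  assert (Hd0 : forall n, 0 <= d n) by (intros; apply Rlt_le, sech_pos).
  (* The diagonal [j = 0] escapes the telescoping formula; its sum [Q] exists because [0 <= d <= 1]
     gives [d^2 <= d]. *)
  destruct (has_sum_le (fun n => d n * d n) d (sech_half_sum h)) as [Q HQ]; [|exact Hd|].
  { intros n. assert (d n <= 1); [|specialize (Hd0 n); nra].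
    unfold d. set (y := (IZR n + / 2) * h). rewrite <- sech_0.
    destruct (Rle_lt_dec 0 y).
    - apply sech_decreasing; lra.
    - rewrite <- (sech_opp y); apply sech_decreasing; lra. }
  set (G := fun j => if Z.eq_dec j 0 then Q else 2 * IZR j / sinh (IZR j * h)).
  assert (HG : forall j, has_sum (fun m => d m * d (m + j)%Z) (G j)).
  { intros j; unfold G. destruct (Z.eq_dec j 0) as [->|Hj].
    - revert HQ; apply has_sum_ext; intros n; now rewrite Z.add_0_r.
    - apply has_sum_ext with (2 := has_sum_sech_pair (h / 2) h j Hh Hj).
      intros n; unfold d. f_equal; f_equal; field. }
  assert (HG0 : forall j, 0 <= G j).
  { intros j. apply (has_sum_ub _ _ [] (HG j)). constructor. }
  assert (HC := has_sum_shear d d _ _ G Hd0 Hd0 Hd Hd HG).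
  assert (Hodd : has_sum (fun i => G (2 * i + 1)%Z) (2 * P)).
  { apply has_sum_ext with
      (fun i => 2 * (IZR (2 * i + 1) / sinh (IZR (2 * i + 1) * h))).
    - intros i; unfold G. destruct (Z.eq_dec (2 * i + 1) 0); [lia|]. unfold Rdiv; ring.
    - apply has_sum_scal; [lra|]. now apply has_sum_even_odd_product. }
  destruct (has_sum_comp_injective _ (fun n => 2 * n)%Z _ ltac:(cbv beta; intros; lia) HC)
    as [W HW].
  assert (HW' : has_sum (fun m => G (2 * m + 1)%Z) W).
  { apply (has_sum_exchange (fun i m => d (m - i)%Z * d (m + i)%Z)
      (fun i => G (2 * i)%Z)).
    - intros i m; now apply Rmult_le_pos.
    - intros i. assert (H := has_sum_shift _ (- i) _ (HG (2 * i)%Z)).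
      revert H; apply has_sum_ext; intros m. do 2 f_equal; lia.
    - intros m. unfold G. destruct (Z.eq_dec (2 * m + 1) 0); [lia|].
      apply has_sum_ext with
        (2 := has_sum_sech_pair (- (IZR m + / 2) * h) h (2 * m + 1) Hh n).
      (* Evenness rewrites [d (m - i)] as [sech] at [(i - (m + 1/2)) h]. As [i] varies, the two
         factors then have the constant gap [2m + 1]. *)
      intros i. unfold d. rewrite <- sech_opp.
      rewrite minus_IZR, !plus_IZR, mult_IZR. f_equal; f_equal; field.
    - exact HW. }
  rewrite (has_sum_unique _ _ _ HW' Hodd) in HW.
  (* The even and the odd diagonals contribute [2 P] each, whence the factor 4. *)
  assert (E := has_sum_unique _ _ _ HC (has_sum_even_odd G _ _ HG0 HW Hodd)).
  simpl; lra.
Qed.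

(** * Gauss's integral and the arithmetic-geometric mean *)

Definition gauss_form (a b t : R) : R := a ^ 2 * cos t ^ 2 + b ^ 2 * sin t ^ 2.

Definition gauss_integral (a b : R) : R :=
  RInt (fun t => / sqrt (gauss_form a b t)) 0 (PI / 2).

Lemma sin_cos_sqr t : sin t ^ 2 + cos t ^ 2 = 1.
Proof. rewrite <- (sin2_cos2 t); unfold Rsqr; ring. Qed.

(** The form is a convex combination of [a^2] and [b^2], with weights [cos t ^ 2] and
    [sin t ^ 2]. *)
Lemma gauss_form_between m M a b t :
  m <= a <= M -> m <= b <= M -> 0 <= m -> m ^ 2 <= gauss_form a b t <= M ^ 2.
Proof.
  intros Ha Hb Hm. unfold gauss_form. assert (H := sin_cos_sqr t).
  assert (0 <= cos t ^ 2) by apply pow2_ge_0. assert (0 <= sin t ^ 2) by apply pow2_ge_0.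
  assert (m ^ 2 <= a ^ 2 <= M ^ 2) by (split; apply pow_incr; lra).
  assert (m ^ 2 <= b ^ 2 <= M ^ 2) by (split; apply pow_incr; lra).
  split; nra.
Qed.

Lemma gauss_form_pos a b t : 0 < a -> 0 < b -> 0 < gauss_form a b t.
Proof.
  intros Ha Hb.
  destruct (gauss_form_between (Rmin a b) (Rmax a b) a b t) as [H _].
  - split; [apply Rmin_l|apply Rmax_l].
  - split; [apply Rmin_r|apply Rmax_r].
  - apply Rmin_glb; lra.
  - apply Rlt_le_trans with (2 := H). apply pow_lt. now apply Rmin_glb_lt.
Qed.

Lemma continuous_gauss_integrand a b t :
  0 < a -> 0 < b -> continuous (fun t => / sqrt (gauss_form a b t)) t.
Proof.
  intros Ha Hb. assert (H := gauss_form_pos a b t Ha Hb).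
  apply (ex_derive_continuous (V := R_NormedModule)).
  unfold gauss_form in *. auto_derive.
  split; [now simpl in *|]. split; [|exact I].
  apply Rgt_not_eq, sqrt_lt_R0. now simpl in *.
Qed.

Lemma ex_RInt_gauss a b x y :
  0 < a -> 0 < b -> ex_RInt (fun t => / sqrt (gauss_form a b t)) x y.
Proof.
  intros Ha Hb. apply (ex_RInt_continuous (V := R_CompleteNormedModule)).
  intros t _; now apply continuous_gauss_integrand.
Qed.

(** Forces the integral towards [PI / (2 m)] when both arguments approach [m]; all limits of
    [gauss_integral] below rest on it. *)
Lemma gauss_integral_between m M a b :
  0 < m -> m <= a <= M -> m <= b <= M ->
  PI / 2 / M <= gauss_integral a b <= PI / 2 / m.
Proof.
  intros Hm Ha Hb. assert (HPI := PI_RGT_0).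
  assert (Hc : forall c, PI / 2 / c = RInt (fun _ => / c) 0 (PI / 2)).
  { intros c. rewrite RInt_const. unfold scal; simpl; unfold mult; simpl.
    unfold Rdiv; ring. }
  rewrite !Hc; unfold gauss_integral; split; apply RInt_le; try lra;
    try apply ex_RInt_const; try (apply ex_RInt_gauss; lra);
    intros t _; destruct (gauss_form_between m M a b t) as [H1 H2]; try lra;
    assert (H := gauss_form_pos a b t ltac:(lra) ltac:(lra)).
  - apply Rinv_le_contravar; [now apply sqrt_lt_R0|].
    rewrite <- (sqrt_pow2 M) by lra. now apply sqrt_le_1_alt.
  - apply Rinv_le_contravar; [assumption|].
    rewrite <- (sqrt_pow2 m) at 1 by lra. now apply sqrt_le_1_alt.
Qed.

Lemma gauss_integral_scal c a b :
  0 < c -> 0 < a -> 0 < b -> gauss_integral (c * a) (c * b) = / c * gauss_integral a b.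
Proof.
  intros Hc Ha Hb. unfold gauss_integral.
  rewrite <- (RInt_scal (V := R_CompleteNormedModule)) by now apply ex_RInt_gauss.
  apply RInt_ext; intros t _. unfold scal; simpl; unfold mult; simpl.
  replace (gauss_form (c * a) (c * b) t) with (c ^ 2 * gauss_form a b t)
    by (unfold gauss_form; ring).
  rewrite sqrt_mult by (try apply pow2_ge_0; now apply Rlt_le, gauss_form_pos).
  rewrite sqrt_pow2 by lra. now rewrite Rinv_mult.
Qed.

(** The integrand is symmetric under [t -> PI - t]. The doubled interval is the image of
    [[0, PI / 2]] under Landen's substitution. *)
Lemma RInt_gauss_0_PI a b : 0 < a -> 0 < b ->
  RInt (fun t => / sqrt (gauss_form a b t)) 0 PI = 2 * gauss_integral a b.
Proof.
  intros Ha Hb.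
  assert (Hrefl : forall t, scal (-1) (/ sqrt (gauss_form a b (-1 * t + PI)))
                            = opp (/ sqrt (gauss_form a b t))).
  { intros t. unfold gauss_form. replace (-1 * t + PI) with (PI - t) by ring.
    rewrite cos_minus, sin_minus, cos_PI, sin_PI.
    replace ((-1 * cos t + 0 * sin t) ^ 2) with (cos t ^ 2) by ring.
    replace ((0 * cos t - -1 * sin t) ^ 2) with (sin t ^ 2) by ring.
    unfold scal, opp; simpl; unfold mult; simpl; ring. }
  rewrite <- (RInt_Chasles (V := R_CompleteNormedModule) _ 0 (PI / 2) PI)
    by now apply ex_RInt_gauss.
  assert (E : RInt (fun t => / sqrt (gauss_form a b t)) (PI / 2) PI = gauss_integral a b).
  { unfold gauss_integral.
    assert (H := RInt_comp_lin (V := R_CompleteNormedModule)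
      (fun t => / sqrt (gauss_form a b t)) (-1) PI (PI / 2) 0).
    replace (-1 * (PI / 2) + PI) with (PI / 2) in H by field.
    replace (-1 * 0 + PI) with PI in H by ring.
    rewrite <- H by now apply ex_RInt_gauss.
    rewrite <- (opp_RInt_swap (V := R_CompleteNormedModule)).
    2:{ apply ex_RInt_ext with (fun t => opp (/ sqrt (gauss_form a b t))).
        - intros t _; now rewrite Hrefl.
        - apply (ex_RInt_opp (V := R_NormedModule)). now apply ex_RInt_gauss. }
    rewrite <- (RInt_opp (V := R_CompleteNormedModule)).
    2:{ apply ex_RInt_ext with (fun t => opp (/ sqrt (gauss_form a b t))).
        - intros t _; now rewrite Hrefl.
        - apply (ex_RInt_opp (V := R_NormedModule)). now apply ex_RInt_gauss. }
    apply RInt_ext; intros t _. rewrite Hrefl. unfold opp; simpl; ring. }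
  rewrite E. fold (gauss_integral a b). unfold plus; simpl; ring.
Qed.

(* Landen's substitution: if tan(phi' - phi) = (b/a) tan phi then
   phi' = landen_angle a b phi, in a form without poles. *)
Definition landen_angle (a b t : R) : R :=
  2 * t + atan ((b - a) * (sin t * cos t) / (a * cos t ^ 2 + b * sin t ^ 2)).

Lemma landen_denominator_pos a b t : 0 < a -> 0 < b -> 0 < a * cos t ^ 2 + b * sin t ^ 2.
Proof.
  intros Ha Hb. assert (H := sin_cos_sqr t).
  assert (0 <= cos t ^ 2) by apply pow2_ge_0. assert (0 <= sin t ^ 2) by apply pow2_ge_0.
  destruct (Rle_lt_dec a b); [apply Rlt_le_trans with a|apply Rlt_le_trans with b]; nra.
Qed.

Lemma is_derive_landen_angle a b t : 0 < a -> 0 < b ->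
  is_derive (landen_angle a b) t
    ((a + b) * (a * cos t ^ 2 + b * sin t ^ 2) / gauss_form a b t).
Proof.
  intros Ha Hb.
  assert (HD := landen_denominator_pos a b t Ha Hb).
  assert (HG := gauss_form_pos a b t Ha Hb).
  assert (H := sin_cos_sqr t).
  unfold landen_angle, gauss_form in *. auto_derive.
  - simpl in HD; lra.
  - set (s := sin t) in *; set (c := cos t) in *; unfold Rsqr in *.
    (* This is the squared modulus of [(a c + i b s) (c - i s) = (a c^2 + b s^2) + i (b - a) s c],
       where the second factor on the left has modulus 1. *)
    assert (E : a ^ 2 * c ^ 2 + b ^ 2 * s ^ 2
                = (a * c ^ 2 + b * s ^ 2) ^ 2 + ((b - a) * (s * c)) ^ 2).
    { replace (a ^ 2 * c ^ 2 + b ^ 2 * s ^ 2) with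
        ((a ^ 2 * c ^ 2 + b ^ 2 * s ^ 2) * (s ^ 2 + c ^ 2)) by (rewrite H; ring). ring. }
    assert (N : (a * c ^ 2 + b * s ^ 2) * (a * c ^ 2 + b * s ^ 2)
                + ((b - a) * (s * c)) * ((b - a) * (s * c)) <> 0) by (simpl in *; nra).
    rewrite E. field_simplify_eq; [|simpl in *; split; nra].
    (* Multiplying one side by [s^2 + c^2 = 1] makes the identity homogeneous, so that [ring] can
       decide it. *)
    match goal with |- ?l = ?r => transitivity (r * (s ^ 2 + c ^ 2)) end;
      [ring|rewrite H; ring].
Qed.

(** The new form is a perfect square over the old one. Dividing the derivative of [landen_angle] by
    its square root leaves [2 / sqrt (gauss_form a b t)]. *)
Lemma gauss_form_landen_angle a b t : 0 < a -> 0 < b ->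
  gauss_form ((a + b) / 2) (sqrt (a * b)) (landen_angle a b t)
  = ((a + b) / 2) ^ 2 * (a * cos t ^ 2 + b * sin t ^ 2) ^ 2 / gauss_form a b t.
Proof.
  intros Ha Hb.
  assert (HD := landen_denominator_pos a b t Ha Hb).
  assert (HG := gauss_form_pos a b t Ha Hb).
  assert (H := sin_cos_sqr t).
  unfold gauss_form at 1. rewrite pow2_sqrt by nra.
  unfold landen_angle. set (D := a * cos t ^ 2 + b * sin t ^ 2) in *.
  set (z := (b - a) * (sin t * cos t) / D).
  rewrite cos_plus, sin_plus, cos_2a, sin_2a, cos_atan, sin_atan.
  assert (Hz : 0 < 1 + Rsqr z) by (assert (Hz := Rle_0_sqr z); lra).
  (* Here [1 / sqrt (1 + z^2)] is the cosine of [atan z]; its square comes from [gauss_form a b t =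
     D^2 + ((b - a) sin t cos t)^2]. *)
  assert (Hw : (/ sqrt (1 + Rsqr z)) ^ 2 = D ^ 2 / gauss_form a b t).
  { rewrite pow_inv, pow2_sqrt by lra. unfold z, Rsqr.
    assert (E : gauss_form a b t = D ^ 2 + ((b - a) * (sin t * cos t)) ^ 2).
    { replace (gauss_form a b t) with (gauss_form a b t * (sin t ^ 2 + cos t ^ 2))
        by (rewrite H; ring). unfold gauss_form, D; ring. }
    rewrite E in HG |- *. field. split; [|lra]. simpl in HG; lra. }
  replace (1 / sqrt (1 + Rsqr z)) with (/ sqrt (1 + Rsqr z)) by (unfold Rdiv; ring).
  replace (z / sqrt (1 + Rsqr z)) with (z * / sqrt (1 + Rsqr z)) by (unfold Rdiv; ring).
  set (w := / sqrt (1 + Rsqr z)) in *.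
  transitivity (w ^ 2 * (((a + b) / 2) ^ 2
      * ((cos t ^ 2 - sin t ^ 2) - 2 * sin t * cos t * z) ^ 2
      + a * b * (2 * sin t * cos t + (cos t ^ 2 - sin t ^ 2) * z) ^ 2)); [field|].
  rewrite Hw. unfold z.
  set (s := sin t) in *; set (c := cos t) in *.
  transitivity ((((a + b) / 2) ^ 2
      * ((c ^ 2 - s ^ 2) * D - 2 * s * c * ((b - a) * (s * c))) ^ 2
      + a * b * (2 * s * c * D + (c ^ 2 - s ^ 2) * ((b - a) * (s * c))) ^ 2)
      / gauss_form a b t); [field; lra|].
  f_equal.
  transitivity (((a + b) / 2) ^ 2 * D ^ 2 * (s ^ 2 + c ^ 2) ^ 2); [|rewrite H; ring].
  unfold D; field.
Qed.

Lemma landen_angle_0 a b : landen_angle a b 0 = 0.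
Proof.
  unfold landen_angle. rewrite sin_0, Rmult_0_l, Rmult_0_r, Rmult_0_r.
  unfold Rdiv; rewrite Rmult_0_l, atan_0; ring.
Qed.

Lemma landen_angle_PI2 a b : landen_angle a b (PI / 2) = PI.
Proof.
  unfold landen_angle. rewrite cos_PI2, Rmult_0_r, Rmult_0_r.
  unfold Rdiv at 2; rewrite Rmult_0_l, atan_0; field.
Qed.

Theorem gauss_integral_agm a b : 0 < a -> 0 < b ->
  gauss_integral ((a + b) / 2) (sqrt (a * b)) = gauss_integral a b.
Proof.
  intros Ha Hb.
  assert (Hm : 0 < (a + b) / 2) by lra.
  assert (Hg : 0 < sqrt (a * b)) by (apply sqrt_lt_R0; nra).
  (* The substitution doubles the integrand and stretches the range to [[0, PI]], so both sides are
     compared after doubling. *)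
  apply Rmult_eq_reg_l with 2; [|lra].
  rewrite <- RInt_gauss_0_PI by assumption.
  rewrite <- (landen_angle_0 a b), <- (landen_angle_PI2 a b) at 1.
  rewrite <- (RInt_comp (V := R_CompleteNormedModule) _ (landen_angle a b)
    (fun t => (a + b) * (a * cos t ^ 2 + b * sin t ^ 2) / gauss_form a b t)).
  - unfold gauss_integral. rewrite <- (RInt_scal (V := R_CompleteNormedModule))
      by now apply ex_RInt_gauss.
    apply RInt_ext; intros t _.
    set (D := a * cos t ^ 2 + b * sin t ^ 2).
    unfold scal; simpl; unfold mult; simpl.
    rewrite gauss_form_landen_angle by assumption.
    assert (HD : 0 < D) by now apply landen_denominator_pos.
    assert (HG := gauss_form_pos a b t Ha Hb).
    fold D. replace (((a + b) / 2) ^ 2 * D ^ 2 / gauss_form a b t)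
      with (((a + b) / 2 * D) ^ 2 / gauss_form a b t) by (field; lra).
    rewrite sqrt_div_alt by assumption. rewrite sqrt_pow2 by nra.
    assert (HS : 0 < sqrt (gauss_form a b t)) by now apply sqrt_lt_R0.
    replace ((a + b) * D / gauss_form a b t)
      with ((a + b) * D / sqrt (gauss_form a b t) ^ 2) by (rewrite pow2_sqrt; lra).
    field. repeat split; lra.
  - intros t _; now apply continuous_gauss_integrand.
  - intros t _; split; [now apply is_derive_landen_angle|].
    apply (ex_derive_continuous (V := R_NormedModule)).
    assert (HG := gauss_form_pos a b t Ha Hb). unfold gauss_form in *.
    auto_derive. simpl in HG; lra.
Qed.

(** * The singular modulus *)

(** This is [B(h)], the even terms minus the odd ones; the difference form stays within sums of
    nonnegative families. *)
Definition sech_alt_sum (h : R) : R := sech_sum (2 * h) - sech_half_sum (2 * h).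

(** The identity [(x + y)^2 = (x - y)^2 + 4 x y] with [x = A(2h)] and [y = C(2h)]. *)
Lemma sech_sum_sqr h : 0 < h ->
  sech_sum h ^ 2 = sech_alt_sum h ^ 2 + sech_half_sum h ^ 2.
Proof.
  intros Hh. rewrite sech_half_sum_sqr by assumption.
  rewrite (sech_sum_split h). unfold sech_alt_sum. ring.
Qed.

(** The left side is [A(2h)^2 - C(2h)^2], a difference of squares. *)
Lemma sech_sum_mul_alt h : 0 < h -> sech_sum h * sech_alt_sum h = sech_alt_sum (2 * h) ^ 2.
Proof.
  intros Hh. assert (H := sech_sum_sqr (2 * h) ltac:(lra)).
  rewrite (sech_sum_split h). unfold sech_alt_sum at 1. lra.
Qed.

Lemma sech_sum_pos h : 0 < h -> 0 < sech_sum h.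
Proof. intros Hh. destruct (sech_sum_bounds h Hh); lra. Qed.

(** Follows from [B(h) = 2 A(2h) - A(h)] and the bounds on [A]. *)
Lemma sech_alt_sum_bounds h : 0 < h -> 1 - PI / h <= sech_alt_sum h <= 1 + PI / h.
Proof.
  intros Hh. assert (E := sech_sum_split h). unfold sech_alt_sum.
  destruct (sech_sum_bounds h Hh) as [H1 _].
  destruct (sech_sum_bounds (2 * h) ltac:(lra)) as [H2 _].
  replace (PI / (2 * h)) with (PI / h / 2) in H2 by (field; lra). lra.
Qed.

Lemma is_lim_seq_half_pow c : is_lim_seq (fun n => c * (/ 2) ^ n) 0.
Proof.
  replace (Finite 0) with (Rbar_mult c 0) by (simpl; f_equal; ring).
  apply is_lim_seq_scal_l, is_lim_seq_geom. rewrite Rabs_pos_eq; lra.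
Qed.

Lemma eventually_half_pow c e : 0 < e -> exists n, c * (/ 2) ^ n < e.
Proof.
  intros He. assert (H := is_lim_seq_half_pow c). apply is_lim_seq_spec in H.
  destruct (H (mkposreal e He)) as [n Hn]. exists n.
  specialize (Hn n (le_n _)). rewrite Rminus_0_r in Hn. simpl in Hn.
  apply Rle_lt_trans with (2 := Hn), Rle_abs.
Qed.

Lemma pow2_pos n : 0 < 2 ^ n.
Proof. apply pow_lt; lra. Qed.

Lemma PI_div_pow2 h n : 0 < h -> PI / (h * 2 ^ n) = PI / h * (/ 2) ^ n.
Proof. intros Hh. rewrite pow_inv. assert (H := pow2_pos n). field; lra. Qed.

(** For [h > PI] the lower bound suffices. Smaller [h] are reached by halving, since
    [A(h) B(h) = B(2h)^2] passes positivity from [2h] to [h]. *)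
Lemma sech_alt_sum_pos h : 0 < h -> 0 < sech_alt_sum h.
Proof.
  intros Hh. destruct (eventually_half_pow (PI / h) 1) as [n Hn]; [lra|].
  rewrite <- PI_div_pow2 in Hn by assumption.
  revert h Hh Hn; induction n as [|n IH]; intros h Hh Hn.
  - simpl in Hn. rewrite Rmult_1_r in Hn. destruct (sech_alt_sum_bounds h Hh). lra.
  - assert (H : 0 < sech_alt_sum (2 * h)).
    { apply IH; [lra|]. replace (2 * h * 2 ^ n) with (h * 2 ^ S n) by (simpl; ring).
      assumption. }
    assert (E := sech_sum_mul_alt h Hh). assert (HA := sech_sum_pos h Hh). nra.
Qed.

(** * Gauss's integral at (A, B) and (A, C) *)

Lemma gauss_integral_alt_double h : 0 < h ->
  gauss_integral (sech_sum h) (sech_alt_sum h)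
  = gauss_integral (sech_sum (2 * h)) (sech_alt_sum (2 * h)).
Proof.
  intros Hh. assert (HA := sech_sum_pos h Hh). assert (HB := sech_alt_sum_pos h Hh).
  assert (HB2 := sech_alt_sum_pos (2 * h) ltac:(lra)).
  rewrite <- gauss_integral_agm by assumption. f_equal.
  - rewrite (sech_sum_split h). unfold sech_alt_sum; field.
  - rewrite sech_sum_mul_alt by assumption. apply sqrt_pow2; lra.
Qed.

(** A value kept along an orbit whose two arguments both approach [m] must be the integral at
    [(m, m)]. Squeezing with [gauss_integral_between] identifies it. *)
Lemma gauss_integral_limit v m :
  0 < m -> (forall e, 0 < e -> exists x y,
    m - e <= x <= m + e /\ m - e <= y <= m + e /\ gauss_integral x y = v) ->
  v = PI / 2 / m.
Proof.
  intros Hm H. assert (HPI := PI_RGT_0).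
  assert (Hb : forall e, 0 < e < m -> (m - e) * v <= PI / 2 <= (m + e) * v).
  { intros e He. destruct (H e) as [x [y [Hx [Hy <-]]]]; [lra|].
    destruct (gauss_integral_between (m - e) (m + e) x y) as [H1 H2]; try lra.
    split.
    - apply (Rmult_le_compat_l (m - e)) in H2; [|lra].
      replace ((m - e) * (PI / 2 / (m - e))) with (PI / 2) in H2 by (field; lra). lra.
    - apply (Rmult_le_compat_l (m + e)) in H1; [|lra].
      replace ((m + e) * (PI / 2 / (m + e))) with (PI / 2) in H1 by (field; lra). lra. }
  assert (Hv : 0 < v) by (destruct (Hb (m / 2)); [lra|nra]).
  enough (E : m * v = PI / 2) by (rewrite <- E; field; lra).
  apply cond_eq; intros eps Heps.
  (* The bound [m / 2] keeps [m - e] positive, and [eps / (2 * v)] makes the error [e * v] at most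
     [eps / 2]. *)
  set (e := Rmin (m / 2) (eps / (2 * v))).
  assert (He : 0 < e) by (apply Rmin_glb_lt; [lra|apply Rdiv_lt_0_compat; lra]).
  assert (He1 : e <= m / 2) by apply Rmin_l.
  assert (He2 : e * v <= eps / 2).
  { replace (eps / 2) with (eps / (2 * v) * v) by (field; lra).
    apply Rmult_le_compat_r; [lra|apply Rmin_r]. }
  destruct (Hb e) as [H1 H2]; [lra|]. apply Rabs_def1; lra.
Qed.

Lemma gauss_integral_sech_alt h : 0 < h ->
  gauss_integral (sech_sum h) (sech_alt_sum h) = PI / 2.
Proof.
  intros Hh. replace (PI / 2) with (PI / 2 / 1) by field.
  apply gauss_integral_limit; [lra|]. intros e He.
  (* After [n] doublings of [h], both sums differ from 1 by at most [PI / (h * 2 ^ n)]. *)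
  destruct (eventually_half_pow (PI / h) e He) as [n Hn].
  rewrite <- PI_div_pow2 in Hn by assumption.
  assert (Hh' : 0 < h * 2 ^ n) by (apply Rmult_lt_0_compat; [|apply pow2_pos]; assumption).
  exists (sech_sum (h * 2 ^ n)), (sech_alt_sum (h * 2 ^ n)).
  destruct (sech_sum_bounds _ Hh') as [H1 _].
  assert (H2 := sech_alt_sum_bounds _ Hh').
  repeat split; try lra.
  clear - Hh. induction n as [|n IH].
  - now rewrite Rmult_1_r.
  - rewrite <- IH, (gauss_integral_alt_double (h * 2 ^ n)).
    + replace (h * 2 ^ S n) with (2 * (h * 2 ^ n)) by (simpl; ring). reflexivity.
    + apply Rmult_lt_0_compat; [assumption|apply pow2_pos].
Qed.

Lemma gauss_integral_half_double h : 0 < h ->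
  gauss_integral (h * sech_sum h) (h * sech_half_sum h)
  = gauss_integral (2 * h * sech_sum (2 * h)) (2 * h * sech_half_sum (2 * h)).
Proof.
  intros Hh. assert (HC := sech_half_sum_pos h Hh).
  assert (HA2 := sech_sum_pos (2 * h) ltac:(lra)).
  assert (HC2 := sech_half_sum_pos (2 * h) ltac:(lra)).
  rewrite <- (gauss_integral_agm (2 * h * _)) by (apply Rmult_lt_0_compat; lra).
  f_equal.
  - rewrite (sech_sum_split h). field.
  - replace (2 * h * sech_sum (2 * h) * (2 * h * sech_half_sum (2 * h)))
      with (h ^ 2 * (4 * (sech_sum (2 * h) * sech_half_sum (2 * h)))) by ring.
    rewrite <- sech_half_sum_sqr, <- Rpow_mult_distr by assumption.
    rewrite sqrt_pow2; [reflexivity|]. nra.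
Qed.

(** Here [h C(h)] is twice [(h / 2) A(h / 2)], which is near [2 PI], minus [h A(h)], which is near
    [PI]. *)
Lemma sech_half_sum_bounds h : 0 < h ->
  PI - 2 * h <= h * sech_half_sum h <= PI + 2 * h.
Proof.
  intros Hh. unfold sech_half_sum.
  destruct (sech_sum_bounds h Hh) as [_ H1].
  destruct (sech_sum_bounds (h / 2) ltac:(lra)) as [_ H2]. lra.
Qed.

Lemma gauss_integral_sech_half h : 0 < h ->
  gauss_integral (sech_sum h) (sech_half_sum h) = h / 2.
Proof.
  intros Hh. assert (HPI := PI_RGT_0).
  assert (HA := sech_sum_pos h Hh). assert (HC := sech_half_sum_pos h Hh).
  (* The integral is homogeneous of degree -1, so the value 1/2 at [(h A, h C)] gives [h / 2] at
     [(A, C)]. *)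
  enough (E : gauss_integral (h * sech_sum h) (h * sech_half_sum h) = PI / 2 / PI).
  { rewrite gauss_integral_scal in E by assumption.
    replace (gauss_integral (sech_sum h) (sech_half_sum h))
      with (h * (/ h * gauss_integral (sech_sum h) (sech_half_sum h))) by (field; lra).
    rewrite E; field; lra. }
  apply gauss_integral_limit; [assumption|]. intros e He.
  (* With [g] the halved parameter, the larger of the two errors is [2 * g], coming from
     [g C(g)]. *)
  destruct (eventually_half_pow (2 * h) e He) as [n Hn].
  set (g := h * (/ 2) ^ n).
  assert (Hg : 0 < g) by (apply Rmult_lt_0_compat; [|apply pow_lt]; lra).
  exists (g * sech_sum g), (g * sech_half_sum g).
  destruct (sech_sum_bounds g Hg) as [_ H1].
  assert (H2 := sech_half_sum_bounds g Hg).
  replace (2 * h * (/ 2) ^ n) with (2 * g) in Hn by (unfold g; ring).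
  repeat split; try lra.
  unfold g. clear - Hh. induction n as [|n IH].
  - now rewrite Rmult_1_r.
  - rewrite <- IH, (gauss_integral_half_double (h * (/ 2) ^ S n)).
    + replace (2 * (h * (/ 2) ^ S n)) with (h * (/ 2) ^ n) by (simpl; field). reflexivity.
    + apply Rmult_lt_0_compat; [assumption|apply pow_lt; lra].
Qed.

(** * Complete elliptic integrals and the modulus C/A *)

(** The relation says [k^2 = 1 - b^2 / a^2], so [1 - k^2 sin^2] is the Gauss form divided by [a^2].
    It serves [K] with [b = B(h)] and [K'] with [b = C(h)]. *)
Lemma ellipticK_gauss_integral a b k : 0 < a -> 0 < b -> a ^ 2 * k ^ 2 = a ^ 2 - b ^ 2 ->
  ellipticK k = a * gauss_integral a b.
Proof.
  intros Ha Hb Hk. unfold ellipticK, gauss_integral.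
  rewrite <- (RInt_scal (V := R_CompleteNormedModule)) by now apply ex_RInt_gauss.
  apply RInt_ext; intros t _.
  change (/ sqrt (1 - k ^ 2 * sin t ^ 2) = a * / sqrt (gauss_form a b t)).
  assert (HG := gauss_form_pos a b t Ha Hb).
  replace (1 - k ^ 2 * sin t ^ 2) with (gauss_form a b t / a ^ 2).
  - rewrite sqrt_div_alt, sqrt_pow2 by (try apply pow_lt; lra).
    rewrite Rinv_div. reflexivity.
  - unfold gauss_form. apply Rmult_eq_reg_l with (a ^ 2); [|apply pow_nonzero; lra].
    assert (H := sin_cos_sqr t).
    replace (a ^ 2 * (1 - k ^ 2 * sin t ^ 2))
      with (a ^ 2 - (a ^ 2 * k ^ 2) * sin t ^ 2) by ring.
    rewrite Hk. replace (cos t ^ 2) with (1 - sin t ^ 2) by lra. field. lra.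
Qed.

Lemma complementary_modulus k : 0 < k < 1 -> 0 < sqrt (1 - k ^ 2) < 1.
Proof.
  intros Hk. assert (0 < k ^ 2) by (apply pow_lt; lra). assert (k ^ 2 < 1) by nra.
  split; [apply sqrt_lt_R0; lra|].
  apply Rlt_le_trans with (sqrt 1); [apply sqrt_lt_1_alt|rewrite sqrt_1]; lra.
Qed.

Lemma ellipticK_integrand_pos k t : 0 < k < 1 -> 0 < 1 - k ^ 2 * sin t ^ 2.
Proof.
  intros Hk. assert (H := sin_cos_sqr t). assert (Hc := pow2_ge_0 (cos t)).
  assert (Hs := pow2_ge_0 (sin t)). assert (k ^ 2 < 1) by nra. nra.
Qed.

Lemma continuous_ellipticK_integrand k t : 0 < k < 1 ->
  continuous (fun t => / sqrt (1 - k ^ 2 * sin t ^ 2)) t.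
Proof.
  intros Hk. assert (H := ellipticK_integrand_pos k t Hk).
  apply (ex_derive_continuous (V := R_NormedModule)). auto_derive.
  simpl in H. unfold Rminus in H. split; [assumption|]. split; [|exact I].
  now apply Rgt_not_eq, sqrt_lt_R0.
Qed.

Lemma ellipticK_pos k : 0 < k < 1 -> 0 < ellipticK k.
Proof.
  intros Hk. assert (HPI := PI_RGT_0). apply RInt_gt_0; [lra| |].
  - intros t _. now apply Rinv_0_lt_compat, sqrt_lt_R0, ellipticK_integrand_pos.
  - intros t _. now apply continuous_ellipticK_integrand.
Qed.

Lemma ellipticK_increasing k l : 0 < k < l -> l < 1 -> ellipticK k < ellipticK l.
Proof.
  intros Hkl Hl. assert (HPI := PI_RGT_0). apply RInt_lt; [lra| | |].
  - intros t _. apply continuous_ellipticK_integrand; lra.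
  - intros t _. apply continuous_ellipticK_integrand; lra.
  - intros t Ht. assert (H := ellipticK_integrand_pos l t ltac:(lra)).
    apply Rinv_lt_contravar.
    + apply Rmult_lt_0_compat; apply sqrt_lt_R0; apply ellipticK_integrand_pos; lra.
    + apply sqrt_lt_1_alt. split; [lra|].
      assert (0 < sin t) by (apply sin_gt_0; lra).
      assert (0 < sin t ^ 2) by (now apply pow_lt). assert (k ^ 2 < l ^ 2) by nra. nra.
Qed.

(** On [(0, 1)], [K] increases and [K'] decreases, so the ratio [K' / K] is strictly decreasing. *)
Lemma singular_modulus_lt_absurd r k l :
  singular_modulus r k -> singular_modulus r l -> ~ k < l.
Proof.
  intros [Hk Ek] [Hl El] Hlt.
  assert (Hk' := complementary_modulus k Hk). assert (Hl' := complementary_modulus l Hl).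
  assert (H1 := ellipticK_increasing k l ltac:(lra) ltac:(lra)).
  assert (H2 : ellipticK' l < ellipticK' k).
  { apply ellipticK_increasing; [split; [lra|]|lra]. apply sqrt_lt_1_alt. nra. }
  assert (Kk := ellipticK_pos k Hk).
  assert (Kl' : 0 < ellipticK' l) by now apply ellipticK_pos.
  enough (ellipticK' l / ellipticK l < ellipticK' k / ellipticK k) by lra.
  apply Rlt_trans with (ellipticK' l / ellipticK k).
  - apply Rmult_lt_compat_l; [assumption|]. apply Rinv_lt_contravar; nra.
  - apply Rmult_lt_compat_r; [now apply Rinv_0_lt_compat|assumption].
Qed.

Lemma singular_modulus_unique r k l :
  singular_modulus r k -> singular_modulus r l -> k = l.
Proof.
  intros Hk Hl. destruct (Rtotal_order k l) as [H|[H|H]]; [|assumption|]; exfalso;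
    revert H; eapply singular_modulus_lt_absurd; eassumption.
Qed.

Section SechModulus.
Variable h : R.
Hypothesis h_pos : 0 < h.
Let k := sech_half_sum h / sech_sum h.

Lemma sech_modulus_range : 0 < k < 1.
Proof.
  assert (HA := sech_sum_pos h h_pos). assert (HB := sech_alt_sum_pos h h_pos).
  assert (HC := sech_half_sum_pos h h_pos). assert (E := sech_sum_sqr h h_pos).
  unfold k; split; [now apply Rdiv_lt_0_compat|].
  apply Rmult_lt_reg_r with (sech_sum h); [assumption|].
  replace (sech_half_sum h / sech_sum h * sech_sum h) with (sech_half_sum h)
    by (field; lra). nra.
Qed.

Lemma ellipticK_sech_modulus : ellipticK k = PI / 2 * sech_sum h.
Proof.
  assert (HA := sech_sum_pos h h_pos). assert (HB := sech_alt_sum_pos h h_pos).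
  rewrite (ellipticK_gauss_integral (sech_sum h) (sech_alt_sum h)); try assumption.
  - rewrite gauss_integral_sech_alt by assumption. ring.
  - rewrite (sech_sum_sqr h) at 2 by assumption. unfold k; field; lra.
Qed.

Lemma ellipticK'_sech_modulus : ellipticK' k = h / 2 * sech_sum h.
Proof.
  assert (HA := sech_sum_pos h h_pos). assert (HC := sech_half_sum_pos h h_pos).
  unfold ellipticK'.
  rewrite (ellipticK_gauss_integral (sech_sum h) (sech_half_sum h)); try assumption.
  - rewrite gauss_integral_sech_half by assumption. ring.
  - rewrite pow2_sqrt by (assert (H := sech_modulus_range); nra). unfold k; field; lra.
Qed.

End SechModulus.

(** [epsilon] satisfies its predicate only once a witness is known. The modulus [C/A] at
    [h = PI * sqrt r] is one, because [K' / K = h / PI] there, and uniqueness identifies it with the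
    chosen value. *)
Lemma lambda_star_sech r : 0 < r ->
  lambda_star r = sech_half_sum (PI * sqrt r) / sech_sum (PI * sqrt r).
Proof.
  intros Hr. assert (HPI := PI_RGT_0). assert (Hs : 0 < sqrt r) by now apply sqrt_lt_R0.
  assert (Hh : 0 < PI * sqrt r) by now apply Rmult_lt_0_compat.
  assert (HA := sech_sum_pos _ Hh).
  assert (Hk : singular_modulus r (sech_half_sum (PI * sqrt r) / sech_sum (PI * sqrt r))).
  { split; [now apply sech_modulus_range|].
    rewrite ellipticK_sech_modulus, ellipticK'_sech_modulus by assumption. field; lra. }
  assert (H : unique (singular_modulus r) (lambda_star r)).
  { unfold lambda_star. apply epsilon_spec.
    exists (sech_half_sum (PI * sqrt r) / sech_sum (PI * sqrt r)).
    split; [assumption|]. intros l; now apply singular_modulus_unique. }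
  now apply H.
Qed.

Theorem corollary2p2 (r : nat) (hr : (1 <= r)%nat) :
  is_pmf_Z (bilateral_hyperbolic_secant r).
Proof.
  assert (HPI := PI_RGT_0).
  assert (Hr : 0 < INR r) by (apply lt_0_INR; lia).
  set (h := PI * sqrt (INR r)).
  assert (Hh : 0 < h) by (apply Rmult_lt_0_compat; [|apply sqrt_lt_R0]; assumption).
  assert (HA := sech_sum_pos h Hh).
  (* Since [K(k_r) = (PI / 2) A(h)], the normalising constant is [1 / A(h)]. *)
  assert (Hp : forall k, bilateral_hyperbolic_secant r k
    = / sech_sum h * sech (IZR k * h)).
  { intros k. unfold bilateral_hyperbolic_secant.
    rewrite lambda_star_sech by assumption. fold h.
    rewrite ellipticK_sech_modulus by assumption.
    replace (sqrt (INR r) * PI * IZR k) with (IZR k * h) by (unfold h; ring).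
    field; lra. }
  split.
  - intros k; rewrite Hp. apply Rlt_le, Rmult_lt_0_compat;
      [now apply Rinv_0_lt_compat|apply sech_pos].
  - set (Q := Series (fun n => sech (INR (S n) * h))).
    exists (/ sech_sum h * (1 + Q)), (/ sech_sum h * Q). repeat split.
    + apply is_series_ext with (fun n => scal (/ sech_sum h) (sech (IZR (Z.of_nat n) * h))).
      * intros n; now rewrite Hp.
      * apply (is_series_scal_l (K := R_AbsRing) (V := R_NormedModule)).
        now apply is_series_sech_nonneg.
    + apply is_series_ext with
        (fun n => scal (/ sech_sum h) (sech (IZR (- Z.of_nat (S n)) * h))).
      * intros n; now rewrite Hp.
      * apply (is_series_scal_l (K := R_AbsRing) (V := R_NormedModule)).
        now apply is_series_sech_neg.
    + replace (/ sech_sum h * (1 + Q) + / sech_sum h * Q)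
        with (/ sech_sum h * (1 + 2 * Q)) by ring.
      change (1 + 2 * Q) with (sech_sum h). apply Rinv_l. lra.
Qed.
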